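(* There exists a positive integer $v_0$ such that for every integer $v\geq v_0$ there exists an idempotent $T_2$-quasigroup of order $v$.
   Context: A quasigroup $(Q,\cdot)$ is a set with a binary operation such that for all $a,c\in Q$ each of the equations $a\cdot x=c$ and $y\cdot a=c$ has a unique solution. Its order is the cardinality of $Q$. It is a $T_2$-quasigroup if $x\cdot(y\cdot(y\cdot x))=y$ for all $x,y\in Q$, and it is idempotent if $x\cdot x=x$ for all $x\in Q$. *)

(* Defs.v *)
From mathcomp Require Import all_boot.

Set Implicit Arguments.
Unset Strict Implicit.
Unset Printing Implicit Defensive.

Definition quasigroup (Q : Type) (op : Q -> Q -> Q) : Prop :=
  forall a c : Q, (exists! x, op a x = c) /\ (exists! y, op y a = c).

Definition T2_quasigroup (Q : Type) (op : Q -> Q -> Q) : Prop :=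
  quasigroup op /\ forall x y : Q, op x (op y (op y x)) = y.

(* Main.v *)
Require Import Defs.
From Stdlib Require Import NArith MSetPositive.
From HB Require Import structures.
From mathcomp Require Import all_boot all_algebra.
From mathcomp Require Import zify ring.

Set Implicit Arguments.
Unset Strict Implicit.
Unset Printing Implicit Defensive.

Import GRing.Theory.

(** Call n an order if it is the order of an idempotent T2-quasigroup. The T2
    law involves two elements only, and idempotent operations on sets meeting
    in at most one point agree there, so operations on the blocks of a design
    glue together: if the points of X are covered by blocks such that two
    distinct points lie in exactly one block, and each block size is an order,
    then #|X| is an order ([T2_order_PBD]).

    The first orders are linear. On an abelian group with an additive f such
    that f^3 = f - 1, the operation x * y = x - f x + f y is an idempotent
    T2-quasigroup ([T2_order_linear]). Multiplication by a root of
    X^3 - X + 1 in Z/n makes n an order, for instance n = 7; the companion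
    matrix of X^3 - X + 1 makes every n^3 an order, for instance 8.

    Since 7 and 8 are both orders, a transversal design with 8 groups of size
    m, one of them cut down to t points, has blocks of sizes 7 and 8 only,
    besides its groups. For m coprime to 30 the lines of slope b in Z/m over
    the abscissas 0, ..., 6, together with a group recording the slope, form
    such a design. Hence 7 m + t is an order as soon as m and t are orders,
    t <= m and m is coprime to 30 ([T2_order_7mDt]).

    This rule propagates any long enough interval of orders to infinity: if
    all of l, ..., u are orders and u is a little more than 8 l, then every
    larger n is 7 m + t with l <= t <= m < n and m = 1 modulo 30
    ([T2_order_bootstrap]). A verified sieve, fed with the roots of
    X^3 - X + 1 modulo small n and with 8, and closed under the rule, finds
    that all integers from 6160 to 51000 are orders, which is long enough. *)

(** * Idempotent T2-quasigroups on finite sets *)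

(** The T2 law exhibits a right inverse to every left translation, so on a
    finite set only the right translations need to be examined. *)
Lemma T2_quasigroup_fin (Q : finType) (op : Q -> Q -> Q) :
    (forall x, injective (op^~ x)) ->
    (forall x y, op x (op y (op y x)) = y) ->
  T2_quasigroup op.
Proof.
move=> inj_r T2; split=> // a c; split.
  have divK : cancel (fun d => op d (op d a)) (op a) by move=> d; apply: T2.
  exists (op c (op c a)); split=> [|x ax]; first exact: T2.
  by rewrite -ax; apply: (canF_sym divK).
have [g _ gK] := injF_bij (inj_r a).
exists (g c); split=> [|y ya]; first exact: gK.
by apply: (inj_r a); rewrite /= ya; apply: gK.
Qed.

Lemma quasigroup_injr (Q : Type) (op : Q -> Q -> Q) :
  quasigroup op -> forall x, injective (op^~ x).
Proof.
move=> qop x y y' /= eq_yx; have [_ [z [_ uniq_z]]] := qop x (op y x).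
by rewrite -(uniq_z y) // (uniq_z y').
Qed.

Definition T2_order (n : nat) : Prop :=
  exists (Q : finType) (op : Q -> Q -> Q),
    #|Q| = n /\ T2_quasigroup op /\ idempotent_op op.

(** An idempotent T2-quasigroup supported by a subset of X: the operation is
    total on X, but constrained on A only, so that the operations of
    different blocks share one type. Right cancellation stands for both
    division axioms, as in [T2_quasigroup_fin]. *)
Record T2_on (X : finType) (A : {set X}) (op : X -> X -> X) : Prop := T2On {
  T2_on_closed : {in A &, forall x y, op x y \in A};
  T2_on_idem : {in A, idempotent_op op};
  T2_on_law : {in A &, forall x y, op x (op y (op y x)) = y};
  T2_on_injr : {in A & &, forall x y y', op y x = op y' x -> y = y'} }.

(** A model of order #|A| is transported to A along a bijection. *)
Lemma T2_order_on (X : finType) (A : {set X}) :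
  T2_order #|A| -> exists op, T2_on A op.
Proof.
case=> Q [op [cardQ [[qop T2op] idop]]].
have [->|[x0 Ax0]] := set_0Vmem A.
  by exists (fun x _ => x); split=> x; rewrite ?inE // => y; rewrite inE.
pose e q : X := enum_val (cast_ord cardQ (enum_rank q)).
pose d x : Q := enum_val (cast_ord (esym cardQ) (enum_rank_in Ax0 x)).
have eA q : e q \in A by apply: enum_valP.
have deK : cancel e d.
  by move=> q; rewrite /d /e enum_valK_in cast_ordK enum_rankK.
have edK : {in A, cancel d e}.
  by move=> x Ax; rewrite /d /e enum_valK cast_ordKV enum_rankK_in.
exists (fun x y => e (op (d x) (d y))); split=> [x y _ _|x Ax|x y Ax Ay|].
- exact: eA.
- by rewrite idop edK.
- by rewrite !deK T2op edK.
move=> x y y' Ax Ay Ay' /(can_inj deK)/(quasigroup_injr qop).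
exact: (can_in_inj edK).
Qed.

(** * Orders are closed under pairwise balanced designs *)

(** The product of x and y is taken in the block through x and y. By
    idempotence it does not matter which block is used when x = y, so the
    operation agrees on each block with the one chosen there; both sides of
    the T2 law for x and y are then computed within one block. *)
Lemma T2_order_PBD (X I : finType) (blk : I -> {set X}) :
    (forall x y, exists i, x \in blk i /\ y \in blk i) ->
    (forall i j x y, x != y -> x \in blk i -> y \in blk i ->
       x \in blk j -> y \in blk j -> i = j) ->
    (forall i, T2_order #|blk i|) ->
  T2_order #|X|.
Proof.
move=> cover meet1 blkT2.
have /fin_all_exists[L LP] : forall p : X * X,
    exists i, p.1 \in blk i /\ p.2 \in blk i by case=> x y; apply: cover.
have Ll x y : x \in blk (L (x, y)) by case: (LP (x, y)).
have Lr x y : y \in blk (L (x, y)) by case: (LP (x, y)).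
have /fin_all_exists[o oP] i : exists op, T2_on (blk i) op.
  exact: T2_order_on.
pose op x y := o (L (x, y)) x y.
have opE i x y : x \in blk i -> y \in blk i -> op x y = o i x y.
  move=> xi yi; rewrite /op; have [<-|neq_xy] := eqVneq x y.
    by rewrite !(T2_on_idem (oP _)) // Ll.
  by rewrite (meet1 (L (x, y)) i x y).
have opC i x y : x \in blk i -> y \in blk i -> op x y \in blk i.
  by move=> xi yi; rewrite (opE i) //; apply: (T2_on_closed (oP i)).
have opL x y : op x y \in blk (L (x, y)) by rewrite opC ?Ll ?Lr.
have opid : idempotent_op op by move=> x; rewrite /op (T2_on_idem (oP _)) ?Ll.
exists X, op; split=> //; split=> //; apply: T2_quasigroup_fin => [x y y'|x y].
  move=> /= eqz.
  (* If the common value z = y * x = y' * x is x, cancelling against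
     x * x = x gives y = x = y'; otherwise the distinct points x and z lie in
     both blocks used, which therefore coincide. *)
  have fix_x u : op u x = x -> u = x.
    have [ui xi] := (Ll u x, Lr u x); rewrite -{2}(opid x).
    rewrite !(opE (L (u, x))) //.
    exact: (T2_on_injr (oP _)).
  have [zx|neq_zx] := eqVneq (op y x) x.
    by rewrite (fix_x y) // (fix_x y') // -eqz.
  have eqL : L (y, x) = L (y', x).
    by apply: meet1 neq_zx _ _ _ _; rewrite ?Lr ?opL // eqz opL.
  move: eqz; rewrite !(opE (L (y, x))) ?Ll ?Lr //; try by rewrite eqL Ll.
  by apply: (T2_on_injr (oP _)); rewrite ?Ll ?Lr // eqL Ll.
have [xi yi] := (Ll x y, Lr x y).
by rewrite !(opE (L (x, y))) ?opC ?(T2_on_law (oP _)) // -?opE ?opC.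
Qed.

(** * Truncated transversal designs *)

Section TruncatedTransversalDesign.

Local Open Scope ring_scope.

(** The full groups are the copies {j} * R of R, for j < k; the last group has
    t points, identified through [e] with t elements of R. The block (a, b) is
    the line y = a + b x over the abscissas c 0, ..., c (k - 1), extended by
    the point of the last group that names its slope b, if there is one.
    Two points on different verticals determine the line because the
    difference of their abscissas is invertible. *)
Lemma T2_order_truncated_TD (R : finComUnitRingType) k t (c : 'I_k -> R) :
    (forall i j, i != j -> c i - c j \is a GRing.unit) -> (t <= #|R|)%N ->
    T2_order k -> T2_order k.+1 -> T2_order #|R| -> T2_order t ->
  T2_order (k * #|R| + t).
Proof.
move=> unit_c le_tR ordk ordk1 ordR ordt.
pose e (s : 'I_t) : R := enum_val (widen_ord le_tR s).
have e_inj : injective e.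
  by move=> s s' /enum_val_inj/(congr1 val)/= /val_inj.
pose X : finType := (('I_k * R) + 'I_t)%type.
pose blk (i : 'I_k + unit + R * R) : {set X} := match i with
  | inl (inl j) => [set p : X | if p is inl q then q.1 == j else false]
  | inl (inr _) => [set p : X | if p is inr _ then true else false]
  | inr (a, b) => [set p : X | match p with
      | inl q => q.2 == a + b * c q.1
      | inr s => e s == b
      end]
  end.
have -> : (k * #|R| + t)%N = #|X| by rewrite card_sum card_prod !card_ord.
apply: (@T2_order_PBD X _ blk).
- move=> [[i x]|s] [[j y]|s'].
  + have [->|neq_ij] := eqVneq i j; first by exists (inl (inl j)); rewrite !inE.
    pose b := (x - y) / (c i - c j).
    exists (inr (x - b * c i, b)); rewrite !inE /= subrK eqxx; split=> //.
    have -> : x - b * c i + b * c j = x - b * (c i - c j) by ring.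
    by rewrite divrK ?unit_c // opprB addrC subrK.
  + by exists (inr (x - e s' * c i, e s')); rewrite !inE /= subrK !eqxx.
  + by exists (inr (y - e s * c j, e s)); rewrite !inE /= subrK !eqxx.
  + by exists (inl (inr tt)); rewrite !inE.
- have same_group (a b : R) (i j g : 'I_k) (x y : R) :
      (i, x) != (j, y) -> i == g -> j == g ->
      x == a + b * c i -> y == a + b * c j -> False.
    move=> neq /eqP ig /eqP jg /eqP xE /eqP yE; case/eqP: neq.
    by rewrite xE yE ig jg.
  have same_trunc (s s' : 'I_t) b : s != s' -> e s == b -> e s' == b -> False.
    by move=> neq /eqP <- /eqP/e_inj eqs; rewrite eqs eqxx in neq.
  case=> [[g|[]]|[a b]] [[g'|[]]|[a' b']] [[i x]|s] [[j y]|s'] neq;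
    rewrite !inE //=.
  + by move=> /eqP <- _ /eqP <-.
  + by move=> ig jg xE yE; case: (same_group a' b' i j g x y).
  + by move=> _ _ sb sb'; case: (same_trunc s s' b').
  + by move=> xE yE ig jg; case: (same_group a b i j g' x y).
  + by move=> sb sb'; case: (same_trunc s s' b).
  + move=> /eqP xE /eqP yE /eqP xE' /eqP yE'.
    have neq_ij : i != j by apply: contraNneq neq => ij; rewrite xE yE ij.
    have bb' : b = b'.
      apply: (mulIr (unit_c _ _ neq_ij)).
      transitivity (x - y); first by rewrite xE yE; ring.
      by rewrite xE' yE'; ring.
    by move: xE; rewrite xE' bb' => /addIr ->.
  + by move=> /eqP -> /eqP <- /eqP xE' /eqP sb'; rewrite sb' in xE' *;
      rewrite (addIr _ xE').
  + by move=> /eqP <- /eqP -> /eqP sb' /eqP yE'; rewrite sb' in yE' *;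
      rewrite (addIr _ yE').
  + by move=> sb sb'; case: (same_trunc s s' b).
- have cardE i : #|blk i| = (#|[pred q : 'I_k * R | inl q \in blk i]|
      + #|[pred s | inr s \in blk i]|)%N.
    by rewrite -!sum1_card big_sumType.
  case=> [[j|[]]|[a b]]; rewrite cardE.
  + suff -> : #|[pred q : 'I_k * R | inl q \in blk (inl (inl j))]| = #|R|.
      by rewrite [X in (_ + X)%N]eq_card0 ?addn0 // => s; rewrite !inE.
    rewrite -sum1_card (eq_bigl (fun q => (q.1 == j) && true)); last first.
      by move=> q; rewrite !inE andbT.
    rewrite -(pair_big (pred1 j) predT (fun _ _ => 1%N)) /= big_pred1_eq.
    by rewrite sum1_card.
  + rewrite eq_card0 => [|q]; last by rewrite !inE.
    by rewrite add0n (eq_card (B := predT)) ?card_ord // => s; rewrite !inE.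
  + have -> : #|[pred q : 'I_k * R | inl q \in blk (inr (a, b))]| = k.
      rewrite -sum1_card (eq_bigl (fun q => true && (q.2 == a + b * c q.1))).
        rewrite -(pair_big_dep predT (fun i x => x == a + b * c i)
                    (fun _ _ => 1%N)) /=.
        under eq_bigr => i _ do rewrite big_pred1_eq.
        by rewrite sum1_card card_ord.
      by move=> q; rewrite !inE.
    have [s /eqP sb|no_s] := pickP (fun s => e s == b).
      rewrite (eq_card (B := pred1 s)) ?card1 ?addn1 // => s'.
      by rewrite !inE -sb (inj_eq e_inj).
    by rewrite eq_card0 ?addn0 // => s; rewrite !inE no_s.
Qed.

End TruncatedTransversalDesign.

(** * Linear models *)

Section LinearModels.

Local Open Scope ring_scope.

(** Expanding x * (y * (y * x)) for x * y = x - f x + f y gives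
    (f^3 - f + 1) x + (f - f^3) y, which is y when f^3 = f - 1. The right
    translations are injective because a fixed point d of f satisfies
    d = f^3 d = f d - d = 0. *)
Lemma T2_order_linear (V : finZmodType) (f : V -> V) :
    {morph f : x y / x + y} -> (forall x, f (f (f x)) = f x - x) ->
  T2_order #|V|.
Proof.
move=> fD f3.
have f0 : f 0 = 0 by apply: (addIr (f 0)); rewrite -fD !add0r.
have fN x : f (- x) = - f x by apply/eqP; rewrite -addr_eq0 -fD addNr f0.
exists V, (fun x y => x - f x + f y); split=> //; split=> [|x]; last first.
  by rewrite subrK.
apply: T2_quasigroup_fin => [x y y' /addIr eq_y|x y].
  have fix_d : f (y - y') = y - y'.
    have {2}-> : y = y' - f y' + f y by rewrite -eq_y subrK.
    by rewrite fD fN [RHS]addrAC [y' - _ - _]addrAC subrr sub0r addrC.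
  apply/eqP; rewrite -subr_eq0; apply/eqP.
  by have := f3 (y - y'); rewrite !fix_d subrr.
rewrite !(fD, fN) !f3 !opprB.
rewrite -(opprB x (f x)) [X in _ + X]addrA [X in _ + X]addrC addNKr addrA subrK.
by rewrite addrC subrK.
Qed.

(** The hypothesis says that b is a root of X^3 - X + 1 modulo n, written
    without subtraction. *)
Lemma T2_order_root n b :
  (0 < n)%N -> (b ^ 3 + 1 = b %[mod n])%N -> T2_order n.
Proof.
move=> n_gt0 rootb; have [n_gt1|n_le1] := ltnP 1 n; last first.
  (* 'Z_1 is Z/2, so the one-element model is treated apart. *)
  have -> : n = #|{: unit}| by rewrite card_unit; lia.
  exists unit, (fun=> id); split=> //; split=> //.
  apply: T2_quasigroup_fin => [x y y'|x y]; last by case: x; case: y.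
  by move=> _; case: y; case: y'.
have {}rootb : b%:R ^+ 3 + 1 = b%:R :> 'Z_n.
  rewrite -natrX -(natrD _ _ 1) -(Zp_nat_mod n_gt1 (b ^ 3 + 1)) rootb.
  by rewrite Zp_nat_mod.
suff : T2_order #|'Z_n| by rewrite card_ord Zp_cast.
apply: (T2_order_linear (f := fun x : 'Z_n => b%:R * x)) => [x y|x].
  by rewrite mulrDr.
have -> : b%:R * (b%:R * (b%:R * x)) = (b%:R ^+ 3 + 1) * x - x by ring.
by rewrite rootb.
Qed.

(** Joins the two structures that a product already carries, so that
    [T2_order_linear] applies to (Z/n)^3. *)
HB.instance Definition _ (U V : finZmodType) := GRing.Zmodule.on (U * V)%type.

(** Here f is the companion matrix of X^3 - X + 1 acting on (Z/n)^3. *)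
Lemma T2_order_cube n : (1 < n)%N -> T2_order (n ^ 3).
Proof.
move=> n_gt1; suff : T2_order #|{: 'Z_n * 'Z_n * 'Z_n}|.
  by rewrite !card_prod !card_ord Zp_cast // !expnS expn0 muln1 mulnA.
pose f (v : 'Z_n * 'Z_n * 'Z_n) := (- v.2, v.1.1 + v.2, v.1.2).
apply: (T2_order_linear (f := f)) => [[[x y] z] [[x' y'] z']|[[x y] z]].
  by congr (_, _, _); rewrite /= ?opprD // addrACA.
by congr (_, _, _); rewrite /=; ring.
Qed.

End LinearModels.

(** * The recursion 7 m + t *)

(** The abscissas are 0, ..., 6: their differences are at most 6 in absolute
    value, hence units modulo m when 2, 3 and 5 do not divide m. *)
Lemma T2_order_7mDt m t : coprime m 30 -> t <= m -> T2_order m -> T2_order t ->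
  T2_order (7 * m + t).
Proof.
have ord7 : T2_order 7 by apply: (@T2_order_root 7 2).
have ord8 : T2_order 8 by apply: (@T2_order_cube 2).
case: (ltnP 1 m) => [m_gt1 | ]; last first.
  (* For m = 1 the sum 7 m + t is 7 or 8. *)
  by case: m t => [|[|//]] [|[|//]].
move=> co_m30 t_le_m ordm ordt.
have cardZ : #|'Z_m| = m by rewrite card_ord Zp_cast.
suff: T2_order (7 * #|'Z_m| + t) by rewrite cardZ.
apply: (T2_order_truncated_TD (R := 'Z_m) (c := fun i : 'I_7 => i%:R%R));
  rewrite ?cardZ //.
have unit_lt (i j : 'I_7) : j < i -> (i%:R - j%:R : 'Z_m)%R \is a GRing.unit.
  move=> ltji; rewrite -natrB ?(ltnW ltji) // unitZpE //.
  (* 30 ^ 2 rather than 30, because of the difference 4. *)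
  apply: (@coprime_dvdr _ (30 ^ 2)); last exact: coprimeXr.
  have := ltn_ord i.
  by case: (i - j)%N (leq_subr j i) (subn_gt0 j i)
    => [|[|[|[|[|[|[|]]]]]]] //; lia.
move=> i j; rewrite -val_eqE neq_ltn => /orP[|/unit_lt//].
by move=> /unit_lt; rewrite -unitrN opprB.
Qed.

(** * A sieve for orders *)

(** The computations below use binary integers and tries. Boolean connectives
    are written as conditionals so that call-by-value evaluation skips their
    second argument. *)

Section Sieve.

Local Open Scope N_scope.

Definition mem (n : N) (A : PositiveSet.t) : bool :=
  if n is Npos p then PositiveSet.mem p A else false.

Definition add (n : N) (A : PositiveSet.t) : PositiveSet.t :=
  if n is Npos p then PositiveSet.add p A else A.

Fixpoint root_below (n : N) (b : nat) : bool :=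
  if b is b'.+1 then
    let x := N.of_nat b' in
    if N.eqb ((x * x * x + 1) mod n) (x mod n) then true else root_below n b'
  else false.

(** The cubic has no root modulo 2 or 3, so only n coprime to 6 are worth
    a search. *)
Definition has_root (n : N) : bool :=
  if N.eqb (N.gcd n 6) 1 then root_below n (N.to_nat n) else false.

(** Looks for a decomposition v = 7 m' + t, with m' running down from m, whose
    parts are known orders; as m' decreases t grows, and the search stops when
    t exceeds m'. *)
Fixpoint splits (fuel : nat) (m v : N) (A : PositiveSet.t) : bool :=
  if fuel is fuel'.+1 then
    let t := v - 7 * m in
    if N.ltb m t then false else
    if (if mem m A then
          if mem t A then coprime (N.to_nat (m mod 30)) 30 else false
        else false) then true
    else splits fuel' (N.pred m) v A
  else false.

(** Roots are searched for modulo numbers below 1000, which suffices to leave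
    no gap between 6160 and 51000; 200 is an ample bound on the number of
    candidates m' to try there. *)
Definition reachable (v : N) (A : PositiveSet.t) : bool :=
  if (if N.ltb v 1000 then has_root v else false) then true
  else splits 200 (v / 7) v A.

Definition step (st : N * PositiveSet.t) : N * PositiveSet.t :=
  let: (v, A) := st in (N.succ v, if reachable v A then add v A else A).

(** The order 8 is put in by hand, since it comes from [T2_order_cube]. *)
Definition sieve (n : N) : PositiveSet.t :=
  (N.iter n step (1, PositiveSet.add 8%positive PositiveSet.empty)).2.

Fixpoint covers (k : nat) (v : N) (A : PositiveSet.t) : bool :=
  if k is k'.+1 then if mem v A then covers k' (N.succ v) A else false
  else true.

Definition sound (A : PositiveSet.t) : Prop :=
  forall n, mem n A -> T2_order (N.to_nat n).

Lemma sound_add n A : T2_order (N.to_nat n) -> sound A -> sound (add n A).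
Proof.
move=> ordn soundA [//|p]; case: n ordn => [|q] //= ordq memp.
  exact: (soundA (Npos p)).
have /PositiveSet.add_spec[->//|] : PositiveSet.In p (PositiveSet.add q A).
  exact: memp.
exact: (soundA (Npos p)).
Qed.

Lemma to_nat_mod x n : N.to_nat (x mod n) = N.to_nat x %% N.to_nat n.
Proof.
have [->|n_neq0] := N.eq_dec n 0; first by rewrite N.mod_0_r modn0.
rewrite {2}(N.div_mod' x n).
have -> : N.to_nat (n * (x / n) + x mod n) =
    (N.to_nat (x / n) * N.to_nat n + N.to_nat (x mod n))%N by lia.
rewrite modnMDl modn_small //.
by have := N.mod_lt x n n_neq0; lia.
Qed.

Lemma root_below_sound n b :
  N.lt 0 n -> root_below n b -> T2_order (N.to_nat n).
Proof.
move=> n_gt0; elim: b => //= b IHb; case: N.eqb_spec => // rootb _.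
apply: (@T2_order_root _ b); first by lia.
rewrite (_ : b ^ 3 + 1 = N.to_nat (N.of_nat b * N.of_nat b * N.of_nat b + 1))%N.
  by rewrite -to_nat_mod rootb to_nat_mod Nnat.Nat2N.id.
by rewrite !expnS expn0; lia.
Qed.

Lemma splits_sound fuel m v A : sound A -> N.le (7 * m) v ->
  splits fuel m v A -> T2_order (N.to_nat v).
Proof.
move=> soundA; elim: fuel m => [//|fuel IH] m le_mv; cbn [splits].
case: N.ltb_spec => // le_tm.
case memm: (mem m A); last by apply: IH; lia.
case memt: (mem _ A); last by apply: IH; lia.
case: ifP => [co _|_]; last by apply: IH; lia.
have -> : N.to_nat v = (7 * N.to_nat m + N.to_nat (v - 7 * m))%N by lia.
apply: T2_order_7mDt; [|by lia|exact: soundA..].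
by rewrite -coprime_modl -[30%N]/(N.to_nat 30) -to_nat_mod.
Qed.

Lemma reachable_sound v A :
  N.lt 0 v -> sound A -> reachable v A -> T2_order (N.to_nat v).
Proof.
move=> v_gt0 soundA; rewrite /reachable; case: ifP => [+ _|_]; last first.
  by apply: splits_sound => //; apply: N.Div0.mul_div_le.
case: ifP => // _; rewrite /has_root; case: ifP => // _.
exact: root_below_sound.
Qed.

Lemma sieve_sound n : sound (sieve n).
Proof.
pose inv (st : N * PositiveSet.t) := N.lt 0 st.1 /\ sound st.2.
suff [] : inv (N.iter n step (1, PositiveSet.add 8%positive PositiveSet.empty)).
  by [].
apply: N.iter_invariant => [[v A] [/= v_gt0 soundA]|]; last first.
  split=> //; apply: (@sound_add 8); first exact: (@T2_order_cube 2).
  by case=> [|[]].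
split; rewrite /=; first by lia.
case: ifP => // reachv; apply: sound_add => //.
exact: reachable_sound soundA reachv.
Qed.

Lemma covers_mem k v A n : covers k v A ->
  N.le v n -> N.lt n (v + N.of_nat k) -> mem n A.
Proof.
elim: k v => [|k IH] v /=; first by lia.
case memv: (mem v A) => // covA le_vn lt_n.
have [<-//|neq] := N.eq_dec v n.
by apply: IH covA _ _; lia.
Qed.

(** 44841 = 51001 - 6160, so that the last number checked is 51000. *)
Lemma sieve_covers : covers (N.to_nat 44841) 6160 (sieve 51000).
Proof. by vm_compute. Qed.

Lemma T2_order_interval n :
  (N.to_nat 6160 <= n <= N.to_nat 51000)%N -> T2_order n.
Proof.
move=> /andP[le_n n_le]; rewrite -[n]Nnat.Nat2N.id.
by apply: (@sieve_sound 51000); apply: covers_mem sieve_covers _ _; lia.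
Qed.

End Sieve.

(** * From an interval to all large orders *)

(** Suitable m must lie between n / 8 and (n - l) / 7, so that
    l <= n - 7 m <= m. Once n exceeds 8 l + 1680 this range is longer than 30
    and contains an m congruent to 1 modulo 30, which is coprime to 30. *)
Lemma T2_order_bootstrap l u : 8 * l + 1680 <= u ->
    (forall n, l <= n <= u -> T2_order n) ->
  forall n, l <= n -> T2_order n.
Proof.
move=> lu seed; elim/ltn_ind=> n IH l_le_n.
have [n_le_u|u_lt_n] := leqP n u; first by apply: seed; rewrite l_le_n.
pose k := (n - l - 7) %/ 210; pose m := 30 * k + 1.
have [mub mlb] : 7 * m <= n - l /\ n <= 8 * m.
  have := divn_eq (n - l - 7) 210.
  have : (n - l - 7) %% 210 < 210 by rewrite ltn_pmod.
  by rewrite /m -/k; lia.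
have -> : n = 7 * m + (n - 7 * m) by lia.
apply: T2_order_7mDt; [|by lia|by apply: IH; lia..].
by rewrite /m coprime_sym /coprime mulnC gcdnMDl.
Qed.

Theorem theorem5p4 :
  exists v0 : nat, 0 < v0 /\
    forall v : nat, v0 <= v ->
      exists (Q : finType) (op : Q -> Q -> Q),
        #|Q| = v /\ T2_quasigroup op /\ idempotent_op op.
Proof.
exists (N.to_nat 6160); split; first by lia.
by apply: T2_order_bootstrap T2_order_interval; lia.
Qed.
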